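(* Let $n\ge6$, let $e=0$ if $n$ is even and $e=1$ if $n$ is odd, and let $D$ be a crossing optimal 2-page book drawing of $K_n$. Then there exists a drawing $D'$ equivalent to $D$ such that $M(D')$ satisfies: (1) for $4+e\le s\le\lfloor n/2\rfloor+1$ and for $n+2+e\le s\le n+\lfloor n/2\rfloor+1$, the entry $(r,s-r)$ is blue for all integers $r$ with $\max\{1,s-n\}\le r\le (s-5)/2$; (2) for $\lceil n/2\rceil+2+e\le s\le n$ and for $n+\lceil n/2\rceil+2+e\le s\le 2n-2-e$, the entry $(r,s-r)$ is red for all integers $r$ with $\max\{1,s-n\}\le r\le(s-5)/2$, except for the entry $(1,n)$, which is blue; (3) if $n$ is odd, the entries $(1,\lceil n/2\rceil+1)$ and $(\lfloor n/2\rfloor,\lceil n/2\rceil+1)$ are red, and the entries $(2,n)$ and $(\lceil n/2\rceil,\lceil n/2\rceil+2)$ are blue.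
   Context: Normalized 2-page book drawings of $K_n$: the vertices are $(1,0),\dots,(n,0)$, labelled $1,\dots,n$ left to right; each edge $i(i+1)$ ($1\le i\le n-1$) is drawn on the $x$-axis (spine); the edge $1n$ is drawn in the upper half-plane; every other edge $ij$ is a semicircle over $[i,j]$ in either the upper or lower half-plane. Edges drawn on the spine or in the upper half-plane are blue, those in the lower half-plane red. The 2-page matrix $M(D)$ has entries $(i,j)$, $1\le i<j\le n$ (row $i$, column $j$), the entry $(i,j)$ having the color of edge $ij$. $D$ is crossing optimal if its number of crossings equals $Z(n)=\frac14\lfloor\frac n2\rfloor\lfloor\frac{n-1}2\rfloor\lfloor\frac{n-2}2\rfloor\lfloor\frac{n-3}2\rfloor$. Transformations of such drawings (specified by colors): $f(D)$ gives edge $(j-1)n$ the color of $1j$ in $D$ for $2\le j\le n$, and edge $(i-1)(j-1)$ the color of $ij$ in $D$ for $1<i<j\le n$; $g(D)$ gives edge $ij$ the color of edge $(n+1-j)(n+1-i)$ in $D$; $h(D)$ switches the color of every edge except the spine edges $i(i+1)$ and the edge $1n$. Two drawings are equivalent if one is obtained from the other by a finite composition of $f,g,h$. *)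

(* Defs.v *)
From mathcomp Require Import all_boot.
Set Implicit Arguments. Unset Strict Implicit. Unset Printing Implicit Defensive.

(* A normalized 2-page book drawing of K_n is encoded by its colouring:
   D i j = true  means edge ij (1 <= i < j <= n) is blue (spine / upper page),
   D i j = false means edge ij is red (lower page).
   Values of D outside 1 <= i < j <= n are irrelevant. *)
Definition coloring := nat -> nat -> bool.

Definition is_drawing (n : nat) (D : coloring) : Prop :=
  forall i j, 1 <= i -> i < j -> j <= n ->
    (j == i.+1) || ((i == 1) && (j == n)) -> D i j = true.

(* Two semicircles ij, kl (i<j, k<l) on the same page cross iff i<k<j<l.
   Spine edges never satisfy i<k<j (no vertex strictly between), and 1n
   is never interleaved, so this counts exactly the crossings. *)
Definition crossings (n : nat) (D : coloring) : nat :=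
  \sum_(i < n.+1) \sum_(k < n.+1) \sum_(j < n.+1) \sum_(l < n.+1)
     [&& 1 <= i, i < k, k < j, j < l, l <= n & D i j == D k l].

(* Z(n) = 1/4 * floor(n/2) floor((n-1)/2) floor((n-2)/2) floor((n-3)/2); the product is divisible by 4 *)
Definition Z (n : nat) : nat :=
  (half n * half (n - 1) * half (n - 2) * half (n - 3)) %/ 4.

Definition crossing_optimal (n : nat) (D : coloring) : Prop :=
  is_drawing n D /\ crossings n D = Z n.

Definition trf (n : nat) (D : coloring) : coloring :=
  fun a b => if b == n then D 1 a.+1 else D a.+1 b.+1.
Definition trg (n : nat) (D : coloring) : coloring :=
  fun a b => D (n.+1 - b) (n.+1 - a).
Definition trh (n : nat) (D : coloring) : coloring :=
  fun a b => if (b == a.+1) || ((a == 1) && (b == n)) then D a b else ~~ D a b.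

Inductive transfo := TF | TG | TH.

Definition apply_tr (n : nat) (t : transfo) (D : coloring) : coloring :=
  match t with TF => trf n D | TG => trg n D | TH => trh n D end.

Definition same_drawing (n : nat) (D1 D2 : coloring) : Prop :=
  forall i j, 1 <= i -> i < j -> j <= n -> D1 i j = D2 i j.

Definition equivalent (n : nat) (D D' : coloring) : Prop :=
  exists s : seq transfo, same_drawing n D' (foldr (apply_tr n) D s).

(* Main.v *)
Require Import Defs.
From mathcomp Require Import all_boot.
From mathcomp Require Import zify.
Set Implicit Arguments. Unset Strict Implicit. Unset Printing Implicit Defensive.

(** A drawing has [3 'C(n, 4)] minus the sum over all edges of (vertices on the left) *
    (vertices on the right) crossings. Removing the last vertex shows by induction that
    the sum of [K - k] over the [k]-edges with [k < K] is at least [3 'C(K + 2, 3)], and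
    the number of crossings is a positive combination of these sums; so a drawing with
    [Z n] crossings has equality for all [K < n./2]. Equality in the induction step, for
    the drawing and all its rotations and reflections, is the local condition [star].

    Two consequences of [star] determine the coloring. First, if two crossing chords
    [px] and [qr] with [p < q < x < r] inside an arc of length at most [n./2 + 1] have the
    same color, then [pr] has this color too. Second, if a vertex sees a whole arc in one
    color, then the [t]-th vertex of that arc sees at least about [n./2 - t] vertices of
    the complementary arc in the other color. Two adjacent longest chords of different
    colors exist by [star]; after a rotation they start at the vertex 1, and the rows of
    their other ends are then monochromatic. The second consequence propagates this to all chords joining the two
    half circles, and the first one to the chords inside a half circle. *)

(** * Side counts *)

(* The arguments of [g] are a permutation of [0, ..., N - 1]: read from the left,
   the positions in [P] get [0, 1, ...] and the other ones [N - 1, N - 2, ...]. *)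
Lemma sum_staircase (g : nat -> nat) (P : nat -> bool) (N : nat) :
  \sum_(0 <= i < N) g ((if P i then 0 else N.-1 - i) + \sum_(0 <= x < i) P x) =
  \sum_(0 <= t < N) g t.
Proof.
elim: N g P => [|N IH] g P; first by rewrite !big_geq.
rewrite big_nat_recl // [\sum_(0 <= x < 0) _]big_geq // addn0 subn0 /=.
have step i : \sum_(0 <= x < i.+1) P x = P 0 + \sum_(0 <= x < i) P x.+1.
  by rewrite big_nat_recl.
case: (boolP (P 0)) => P0.
- rewrite [RHS]big_nat_recl //; congr addn.
  rewrite -(IH (fun t => g t.+1) (fun x => P x.+1)).
  apply: eq_bigr => i _; rewrite step P0; congr g; case: (P i.+1); lia.
- rewrite [RHS]big_nat_recr //= addnC; congr addn.
  rewrite -(IH g (fun x => P x.+1)).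
  apply: eq_bigr => i _; rewrite step (negbTE P0); congr g; case: (P i.+1); lia.
Qed.

(* The triangle on i < j < k is positively oriented exactly when its longest edge ik
   is blue. So [side D true N i j] and [side D false N i j] are the numbers of vertices
   among 1, ..., N on the left and on the right of the edge ij; the three summands
   count the vertices after j, between i and j, and before i. *)
Definition side (D : coloring) (b : bool) (N i j : nat) : nat :=
  \sum_(j.+1 <= y < N.+1) (D i y == b) + (if D i j == b then 0 else j - i.+1)
  + \sum_(1 <= x < i) (D x j == b).

(** The part of [side] that depends on row [i] alone; for fixed [i] it runs through a permutation of
    an initial segment. *)
Definition rank (D : coloring) (b : bool) (N i j : nat) : nat :=
  \sum_(j.+1 <= y < N.+1) (D i y == b) + (if D i j == b then 0 else j - i.+1).

Lemma sum_rank (g : nat -> nat) (D : coloring) b N i : i <= N ->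
  \sum_(i.+1 <= j < N.+1) g (rank D b N i j) = \sum_(0 <= t < N - i) g t.
Proof.
move=> iN; rewrite -(sum_staircase g (fun k => D i (N - k) == b)).
rewrite big_nat_rev /= -{1}[i.+1]add0n big_addn subSS.
rewrite big_nat_cond [RHS]big_nat_cond; apply: eq_bigr => k; rewrite andbT => kN.
rewrite /rank; have -> : i.+1 + N.+1 - (k + i.+1).+1 = N - k by lia.
rewrite addnC; congr (g (_ + _)); first by case: ifP => // _; lia.
rewrite big_nat_rev /= -{1}[(N - k).+1]add0n big_addn.
have -> : N.+1 - (N - k).+1 = k by lia.
rewrite big_nat_cond [RHS]big_nat_cond; apply: eq_bigr => y; rewrite andbT => yk.
by have -> : (N - k).+1 + N.+1 - (y + (N - k).+1).+1 = N - y by lia.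
Qed.

(** With nothing after the last vertex, its column read from the top is exactly the pattern of
    [sum_staircase]. *)
Lemma sum_side_last (g : nat -> nat) (D : coloring) b N :
  \sum_(1 <= i < N.+1) g (side D b N.+1 i N.+1) = \sum_(0 <= t < N) g t.
Proof.
rewrite -(sum_staircase g (fun k => D k.+1 N.+1 == b)).
rewrite big_add1 /=.
rewrite big_nat_cond [RHS]big_nat_cond; apply: eq_bigr => k; rewrite andbT => kN.
rewrite /side [X in X + _ + _]big_geq // add0n big_add1 /=.
by congr (g (_ + _)); case: ifP => // _; lia.
Qed.

Lemma side_rank D b N i j :
  side D b N i j = rank D b N i j + \sum_(1 <= x < i) (D x j == b).
Proof. by []. Qed.

Lemma leq_sum_nat (F G : nat -> nat) a c :
  (forall x, a <= x < c -> F x <= G x) -> \sum_(a <= x < c) F x <= \sum_(a <= x < c) G x.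
Proof.
by move=> FG; rewrite big_nat_cond [leqRHS]big_nat_cond; apply: leq_sum => x; rewrite andbT => /FG.
Qed.

Lemma sum_nat_leq_eq (F G : nat -> nat) a c :
  (forall x, a <= x < c -> F x <= G x) ->
  \sum_(a <= x < c) G x <= \sum_(a <= x < c) F x ->
  forall x, a <= x < c -> F x = G x.
Proof.
elim: c => [|c IH] FG le x xc; first by lia.
have ac : a <= c by lia.
move: le; rewrite !big_nat_recr //= => le.
have le1 : \sum_(a <= x < c) F x <= \sum_(a <= x < c) G x.
  by apply: leq_sum_nat => y yc; apply: FG; lia.
have le2 : F c <= G c by apply: FG; lia.
case: (ltngtP x c) => [xc' | | ->]; [|lia|lia].
apply: IH => [y yc||]; [apply: FG; lia|lia|lia].
Qed.

Lemma sum_bool_split (P Q : nat -> bool) a c :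
  (forall x, Q x = ~~ P x) ->
  \sum_(a <= x < c) (P x : nat) + \sum_(a <= x < c) (Q x : nat) = c - a.
Proof.
move=> PQ; rewrite -big_split /= -[RHS]muln1 -sum_nat_const_nat.
by apply: eq_bigr => x _; rewrite PQ; case: (P x).
Qed.

Lemma eqb_neg (x b : bool) : (x == ~~ b) = ~~ (x == b).
Proof. by case: x; case: b. Qed.

Lemma side_compl D b N i j : 0 < i -> i < j -> j <= N ->
  side D b N i j + side D (~~ b) N i j = N - 2.
Proof.
move=> i0 ij jN; rewrite /side eqb_neg.
have E1 := @sum_bool_split (fun y => D i y == b) (fun y => D i y == ~~ b) j.+1 N.+1
  (fun y => eqb_neg _ _).
have E2 := @sum_bool_split (fun x => D x j == b) (fun x => D x j == ~~ b) 1 i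
  (fun x => eqb_neg _ _).
case: ifP => _ /=; lia.
Qed.

Lemma side_recr D b N i j : j <= N ->
  side D b N.+1 i j = side D b N i j + (D i N.+1 == b).
Proof. by move=> jN; rewrite /side big_nat_recr //=; lia. Qed.

(** * Sums over pairs and the lower bound on small sides *)

Definition sum_pairs (N : nat) (F : nat -> nat -> nat) : nat :=
  \sum_(1 <= j < N.+1) \sum_(1 <= i < j) F i j.

Lemma sum_pairs_recr N F :
  sum_pairs N.+1 F = sum_pairs N F + \sum_(1 <= i < N.+1) F i N.+1.
Proof. by rewrite /sum_pairs big_nat_recr. Qed.

Lemma eq_sum_pairs N F G :
  (forall i j, 0 < i -> i < j -> j <= N -> F i j = G i j) ->
  sum_pairs N F = sum_pairs N G.
Proof.
move=> FG; apply: eq_big_nat => j jN; apply: eq_big_nat => i ij; apply: FG; lia.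
Qed.

Lemma sum_pairsD N F G :
  sum_pairs N (fun i j => F i j + G i j) = sum_pairs N F + sum_pairs N G.
Proof. by rewrite /sum_pairs -big_split; apply: eq_bigr => j _; rewrite big_split. Qed.

Lemma sum_pairs_rows N F :
  sum_pairs N F = \sum_(1 <= i < N.+1) \sum_(i.+1 <= j < N.+1) F i j.
Proof.
elim: N => [|N IH]; first by rewrite /sum_pairs !big_geq.
rewrite sum_pairs_recr IH [RHS]big_nat_recr //= [X in _ = _ + X]big_geq // addn0.
rewrite -big_split /=; apply: eq_big_nat => i iN.
by rewrite [RHS]big_nat_recr //=; lia.
Qed.

(* For 2K < N this is the sum of K - k over all k-edges with k < K, where a k-edge has
   exactly k vertices on one side: the truncated subtractions discard the larger side. *)
Definition small_side_sum (D : coloring) (K N : nat) : nat :=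
  sum_pairs N (fun i j => (K - side D true N i j) + (K - side D false N i j)).

(* The number of vertices on the side of ij that does not contain the vertex N + 1. *)
Definition opp_side D N i j := side D (~~ D i N.+1) N i j.

Lemma sum_trunc K N : K <= N -> \sum_(0 <= t < N) (K - t) = 'C(K.+1, 2).
Proof.
move=> KN; rewrite (big_cat_nat (leq0n K) KN) /=.
rewrite [X in _ + X]big1_seq ?addn0; last first.
  by move=> i /=; rewrite mem_index_iota; lia.
rewrite -bin2_sum big_nat_rev /= [RHS]big_nat_recl // add0n.
by apply: eq_big_nat => i iK; lia.
Qed.

(** On the side of an old edge that receives [N.+1], [K] and the count both grow by one. The other
    side gains one exactly when [opp_side] is at most [K]. The new edges have a permutation of 0,
    ..., N - 1 on each side. *)
Lemma small_side_sum_recr D K N : K.+1 <= N ->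
  small_side_sum D K.+1 N.+1 =
  small_side_sum D K N + sum_pairs N (fun i j => opp_side D N i j <= K) + 2 * 'C(K.+2, 2).
Proof.
move=> KN; rewrite /small_side_sum sum_pairs_recr -sum_pairsD; congr addn.
- apply: eq_sum_pairs => i j i0 ij jN; rewrite !side_recr // /opp_side.
  by case: (D i N.+1) => /=; lia.
- rewrite big_split /= (sum_side_last (fun t => K.+1 - t)).
  by rewrite (sum_side_last (fun t => K.+1 - t)) sum_trunc //; lia.
Qed.

Lemma sum_shift_le K a N : K.+1 - a <= N ->
  \sum_(0 <= t < N) (t + a <= K : nat) = K.+1 - a.
Proof.
move=> le; rewrite (big_cat_nat (leq0n _) le) /=.
rewrite [X in _ + X]big1_seq ?addn0; last first.
  by move=> i /=; rewrite mem_index_iota => /andP[] *; apply/eqP; rewrite eqb0; lia.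
rewrite -[RHS]muln1 -[in RHS](subn0 (K.+1 - a)) -sum_nat_const_nat.
by apply: eq_big_nat => i iK; apply/eqP; rewrite eqb1; lia.
Qed.

Lemma sum_bool_le (P : nat -> bool) a c : \sum_(a <= x < c) (P x : nat) <= c - a.
Proof. by have := @sum_bool_split P (fun x => ~~ P x) a c (fun x => erefl); lia. Qed.

(** Bounding the part before [i] by its maximum [i.-1] leaves a condition on row [i] only, so its
    solutions can be counted exactly. *)
Lemma rank_opp_side_le D K N i j :
  0 < i -> rank D (~~ D i N.+1) N i j + i.-1 <= K -> opp_side D N i j <= K.
Proof.
move=> i0; rewrite /opp_side side_rank.
by have := sum_bool_le (fun x => D x j == ~~ D i N.+1) 1 i; lia.
Qed.

Lemma sum_pairs_rank D K N : K.+2 <= N ->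
  sum_pairs N (fun i j => rank D (~~ D i N.+1) N i j + i.-1 <= K) = 'C(K.+2, 2).
Proof.
move=> KN; rewrite sum_pairs_rows.
rewrite -(@sum_trunc K.+1 N) ?(ltnW KN) // big_add1 /=.
apply: eq_big_nat => i iN.
rewrite (sum_rank (fun t => t + i.+1.-1 <= K)) /=; last by lia.
by rewrite sum_shift_le //; lia.
Qed.

Lemma leq_sum_pairs N F G :
  (forall i j, 0 < i -> i < j -> j <= N -> F i j <= G i j) ->
  sum_pairs N F <= sum_pairs N G.
Proof.
move=> FG; apply: leq_sum_nat => j jN; apply: leq_sum_nat => i ij; apply: FG; lia.
Qed.

Lemma sum_pairs_leq_eq N F G :
  (forall i j, 0 < i -> i < j -> j <= N -> F i j <= G i j) ->
  sum_pairs N G <= sum_pairs N F ->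
  forall i j, 0 < i -> i < j -> j <= N -> F i j = G i j.
Proof.
move=> FG le i j i0 ij jN.
have inn k : 1 <= k < N.+1 -> forall x, 1 <= x < k -> F x k <= G x k.
  by move=> kN x xk; apply: FG; lia.
have E := @sum_nat_leq_eq (fun j => \sum_(1 <= i < j) F i j)
  (fun j => \sum_(1 <= i < j) G i j) 1 N.+1
  (fun k kN => leq_sum_nat (inn k kN)) le j.
apply: (@sum_nat_leq_eq (F^~ j) (G^~ j) 1 j) => [x xj||]; last by lia.
- by apply: FG; lia.
- by rewrite -E //; lia.
Qed.

Lemma small_side_sum_ge D K N : 2 * K < N -> 3 * 'C(K.+2, 3) <= small_side_sum D K N.
Proof.
elim: K N => [|K IH] [|N] KN //.
rewrite small_side_sum_recr; last by lia.
rewrite [in X in X <= _]binS.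
have IH' := IH N ltac:(lia).
have : 'C(K.+2, 2) <= sum_pairs N (fun i j => opp_side D N i j <= K).
  rewrite -(@sum_pairs_rank D K N); last by lia.
  apply: leq_sum_pairs => i j i0 ij jN.
  by have := @rank_opp_side_le D K N i j i0; case: (rank D _ N _ _ + _ <= K) => // ->.
lia.
Qed.

(** Equality in the induction step makes the two indicators compared by [rank_opp_side_le] agree at
    every edge. *)
Lemma small_side_sum_tight D K N i j : 2 * K.+1 < N.+1 ->
  small_side_sum D K.+1 N.+1 = 3 * 'C(K.+3, 3) ->
  0 < i -> i < j -> j <= N -> opp_side D N i j <= K ->
  rank D (~~ D i N.+1) N i j + i.-1 <= K.
Proof.
move=> KN; rewrite small_side_sum_recr; last by lia.
rewrite (binS K.+2 2) => E i0 ij jN inn.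
have le := @small_side_sum_ge D K N ltac:(lia).
have E2 : (rank D (~~ D i N.+1) N i j + i.-1 <= K : nat) = (opp_side D N i j <= K).
  apply: (@sum_pairs_leq_eq N (fun i j => rank D (~~ D i N.+1) N i j + i.-1 <= K)
     (fun i j => opp_side D N i j <= K)) => //.
  - move=> a b a0 ab bN.
    by have := @rank_opp_side_le D K N a b a0; case: (rank D _ N _ _ + _ <= K) => // ->.
  - by rewrite sum_pairs_rank; lia.
by move: E2; rewrite inn; case: (_ <= K).
Qed.

(** * Crossings and side counts *)

Lemma sum_nat_restrict (F : nat -> nat) n k : k <= n ->
  (forall i, ~~ (1 <= i < k) -> F i = 0) ->
  \sum_(0 <= i < n) F i = \sum_(1 <= i < k) F i.
Proof.
move=> kn F0.
case: k kn F0 => [|k] kn F0.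
  by rewrite big1 ?big_geq // => i _; apply: F0; lia.
rewrite (big_cat_nat (leq0n _) kn) /= big_ltn // F0 // add0n.
rewrite [X in _ + X]big1_seq ?addn0 // => i /=; rewrite mem_index_iota => ik.
by apply: F0; lia.
Qed.

(** Crossings are grouped by their largest endpoint [l], to suit induction on the last vertex. *)
Definition crossings_last (D : coloring) (N l : nat) : nat :=
  sum_pairs N (fun k j => \sum_(1 <= i < k) (D i j == D k l)).

Definition nested_crossings (D : coloring) (N : nat) : nat :=
  \sum_(1 <= l < N.+1) crossings_last D l.-1 l.

Lemma crossingsE n D : crossings n D = nested_crossings D n.
Proof.
rewrite /crossings.
under eq_bigr => i _.
  under eq_bigr => k _ do rewrite exchange_big /=.
  rewrite exchange_big /=.
  under eq_bigr => l _ do rewrite exchange_big /=.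
  over.
rewrite exchange_big /=.
under eq_bigr => l _.
  rewrite exchange_big /=.
  under eq_bigr => j _ do rewrite exchange_big /=.
  over.
pose F l j k i : nat := [&& 1 <= i, i < k, k < j, j < l, l <= n & D i j == D k l].
transitivity (\sum_(0 <= l < n.+1) \sum_(0 <= j < n.+1)
   \sum_(0 <= k < n.+1) \sum_(0 <= i < n.+1) F l j k i).
  rewrite big_mkord; apply: eq_bigr => l _; rewrite big_mkord; apply: eq_bigr => j _.
  by rewrite big_mkord; apply: eq_bigr => k _; rewrite big_mkord.
have F0 l j k i : ~~ [&& 1 <= i, i < k, k < j, j < l & l <= n] -> F l j k i = 0.
  move=> H; apply/eqP; rewrite /F eqb0; apply: contra H.
  by move=> /and5P[-> -> -> ->]/andP[-> _].
rewrite (sum_nat_restrict (leqnn n.+1)); last first.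
  move=> l H; rewrite big1 // => j _; rewrite big1 // => k _; rewrite big1 // => i _.
  by apply: F0; lia.
apply: eq_big_nat => l ln; rewrite /crossings_last /sum_pairs prednK; last by lia.
rewrite (@sum_nat_restrict _ _ l); first last.
- by move=> j H; rewrite big1 // => k _; rewrite big1 // => i _; apply: F0; lia.
- by lia.
apply: eq_big_nat => j jl; rewrite (@sum_nat_restrict _ _ j); first last.
- by move=> k H; rewrite big1 // => i _; apply: F0; lia.
- by lia.
apply: eq_big_nat => k kj; rewrite (@sum_nat_restrict _ _ k); first last.
- by move=> i H; apply: F0; lia.
- by lia.
by apply: eq_big_nat => i ik; rewrite /F; congr nat_of_bool; case: (D i j == _); lia.
Qed.

Lemma sum_bin2 N : \sum_(0 <= i < N) 'C(i, 2) = 'C(N, 3).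
Proof.
elim: N => [|N IH]; first by rewrite big_geq.
by rewrite big_nat_recr //= IH binS.
Qed.

Lemma sum_mul_compl N : \sum_(0 <= t < N) t * (N.-1 - t) = 'C(N, 3).
Proof.
elim: N => [|N IH]; first by rewrite big_geq.
rewrite big_nat_recr //= subnn muln0 addn0 binS -IH -bin2_sum -big_split /=.
apply: eq_big_nat => t tN; have -> : N - t = (N.-1 - t).+1; last by rewrite mulnS addnC.
by lia.
Qed.

Lemma sum_pairs_pos N : sum_pairs N (fun k _ => k.-1) = 'C(N, 3).
Proof.
rewrite /sum_pairs big_add1 /= -sum_bin2; apply: eq_bigr => j _.
by rewrite big_add1 /= bin2_sum.
Qed.

(** The ranks contribute one 'C(N, 3). Each triple x < i < j gives either a crossing with the last
    vertex or a unit of the rest of [opp_side], which is the other 'C(N, 3). *)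
Lemma sum_opp_side D N :
  sum_pairs N (opp_side D N) + crossings_last D N N.+1 = 2 * 'C(N, 3).
Proof.
have -> : sum_pairs N (opp_side D N) = sum_pairs N (fun i j => rank D (~~ D i N.+1) N i j)
   + sum_pairs N (fun i j => \sum_(1 <= x < i) (D x j == ~~ D i N.+1)).
  by rewrite -sum_pairsD; apply: eq_sum_pairs => i j _ _ _; rewrite /opp_side side_rank.
rewrite mul2n -addnn -addnA; congr addn.
- rewrite sum_pairs_rows -sum_bin2 [RHS]big_nat_rev /= big_add1 /=.
  apply: eq_big_nat => i iN; rewrite (sum_rank id) ?bin2_sum; last by lia.
  by rewrite add0n.
- rewrite -sum_pairsD -sum_pairs_pos; apply: eq_sum_pairs => i j i0 ij jN.
  rewrite addnC (@sum_bool_split (fun x => D x j == D i N.+1)); first by lia.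
  by move=> x; rewrite eqb_neg.
Qed.

(* Among four vertices, 3 pairs separate the other two if there is no crossing, and
   2 otherwise. *)
Theorem nested_crossings_sides D N :
  nested_crossings D N + sum_pairs N (fun i j => side D true N i j * side D false N i j) =
  3 * 'C(N, 4).
Proof.
elim: N => [|N IH]; first by rewrite /nested_crossings /sum_pairs !big_geq.
rewrite /nested_crossings big_nat_recr //= -/(nested_crossings D N) sum_pairs_recr.
have -> : sum_pairs N (fun i j => side D true N.+1 i j * side D false N.+1 i j) =
   sum_pairs N (fun i j => side D true N i j * side D false N i j) + sum_pairs N (opp_side D N).
  rewrite -sum_pairsD; apply: eq_sum_pairs => i j i0 ij jN; rewrite !side_recr // /opp_side.
  by case: (D i N.+1) => /=; lia.
have -> : \sum_(1 <= i < N.+1) side D true N.+1 i N.+1 * side D false N.+1 i N.+1 = 'C(N, 3).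
  rewrite -sum_mul_compl -(@sum_side_last (fun t => t * (N.-1 - t)) D true).
  apply: eq_big_nat => i iN; congr muln.
  by have := @side_compl D true N.+1 i N.+1; rewrite /=; lia.
by rewrite binS; have := sum_opp_side D N; lia.
Qed.

(** * Optimality forces equality *)

Lemma sum_subn_bin a H : \sum_(0 <= k < H) (k - a) = 'C(H - a, 2).
Proof.
elim: H => [|H IH]; first by rewrite big_geq.
rewrite big_nat_recr //= IH.
case: (leqP a H) => aH; first by rewrite subSn // binS bin1.
by rewrite (eqP (ltnW aH : H - a == 0)) (eqP (aH : H.+1 - a == 0)).
Qed.

Lemma bin2_mul2 x : 'C(x, 2) * 2 = x * (x - 1).
Proof. by rewrite -[2]/(2`!) bin_ffact !ffactnS ffactn0 muln1 subn1. Qed.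

Lemma bin4_mul24 x : 'C(x, 4) * 24 = x * (x - 1) * (x - 2) * (x - 3).
Proof.
rewrite -[24]/(4`!) bin_ffact !ffactnS ffactn0 muln1 -!mulnA.
by congr (_ * (_ * (_ * _))); lia.
Qed.

(** Measures how far the product of the two side counts falls below its balanced value, in the
    truncated terms of [small_side_sum]. *)
Lemma mul_add_trunc (e : bool) h a b : a + b = 2 * h + e ->
  a * b + (\sum_(0 <= k < h.+1) ((k - a) + (k - b)) +
           \sum_(0 <= k < h + e) ((k - a) + (k - b))) = h * (h + e).
Proof.
wlog le : a b / a <= h.
  move=> W ab; case: (leqP a h) => ah; first exact: W.
  rewrite mulnC -(W b a); [|lia|lia]; congr (_ + (_ + _)).
  - by apply: eq_bigr => k _; rewrite addnC.
  - by apply: eq_bigr => k _; rewrite addnC.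
move=> ab; rewrite !big_split /= !sum_subn_bin.
rewrite (@bin_small (h.+1 - b)); last by lia.
rewrite (@bin_small (h + e - b)); last by lia.
have [d hd] : exists d, h = a + d by exists (h - a); lia.
have E1 := bin2_mul2 (h.+1 - a); have E2 := bin2_mul2 (h + e - a).
have eb : b = a + 2 * d + e by lia.
move: E1 E2; have -> : h.+1 - a = d.+1 by lia.
have -> : h + e - a = d + e by lia.
have -> : d.+1 - 1 = d by lia.
rewrite eb hd; clear; case: e => /=.
- have -> : d + true - 1 = d by lia.
  nia.
- case: d => [|d]; first by nia.
  have -> : d.+1 + false - 1 = d by lia.
  nia.
Qed.

Lemma sum_pairs_const N c : sum_pairs N (fun _ _ => c) = 'C(N, 2) * c.
Proof.
rewrite /sum_pairs -bin2_sum big_distrl /= big_add1 /=.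
by apply: eq_bigr => j _; rewrite sum_nat_const_nat subn1.
Qed.

Lemma sum_pairs_sum H N (F : nat -> nat -> nat -> nat) :
  \sum_(0 <= k < H) sum_pairs N (F k) =
  sum_pairs N (fun i j => \sum_(0 <= k < H) F k i j).
Proof.
rewrite /sum_pairs exchange_big /=; apply: eq_bigr => j _.
by rewrite exchange_big.
Qed.

Lemma crossings_small_side_sum D (e : bool) h n : n = 2 * h + 2 + e ->
  crossings n D + 'C(n, 2) * (h * (h + e)) =
  3 * 'C(n, 4) +
    (\sum_(0 <= k < h.+1) small_side_sum D k n + \sum_(0 <= k < h + e) small_side_sum D k n).
Proof.
move=> En; rewrite -(nested_crossings_sides D n) crossingsE -!addnA; congr addn.
rewrite -sum_pairs_const !sum_pairs_sum -!sum_pairsD.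
apply: eq_sum_pairs => i j i0 ij jn; symmetry; apply: mul_add_trunc.
by have := @side_compl D true n i j i0 ij jn; rewrite /=; lia.
Qed.

Lemma sum_bin3 H : \sum_(0 <= k < H) 'C(k.+2, 3) = 'C(H.+2, 4).
Proof.
elim: H => [|H IH]; first by rewrite big_geq.
by rewrite big_nat_recr //= IH [RHS]binS.
Qed.

Lemma Z_even h : Z (2 * h.+1 + 2) * 4 = h.+2 * h.+1 * h.+1 * h.
Proof.
rewrite /Z; have -> : half (2 * h.+1 + 2) = h.+2 by lia.
have -> : half (2 * h.+1 + 2 - 1) = h.+1 by lia.
have -> : half (2 * h.+1 + 2 - 2) = h.+1 by lia.
have -> : half (2 * h.+1 + 2 - 3) = h by lia.
have E1 := bin2_mul2 h.+2; have E2 := bin2_mul2 h.+1.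
rewrite divnK //; apply/dvdnP; exists ('C(h.+2, 2) * 'C(h.+1, 2)).
move: E1 E2; have -> : h.+2 - 1 = h.+1 by lia.
have -> : h.+1 - 1 = h by lia.
nia.
Qed.

Lemma Z_odd h : Z (2 * h.+1 + 3) * 4 = h.+2 * h.+2 * h.+1 * h.+1.
Proof.
rewrite /Z; have -> : half (2 * h.+1 + 3) = h.+2 by lia.
have -> : half (2 * h.+1 + 3 - 1) = h.+2 by lia.
have -> : half (2 * h.+1 + 3 - 2) = h.+1 by lia.
have -> : half (2 * h.+1 + 3 - 3) = h.+1 by lia.
have E1 := bin2_mul2 h.+2.
rewrite divnK //; apply/dvdnP; exists ('C(h.+2, 2) * 'C(h.+2, 2)).
move: E1; have -> : h.+2 - 1 = h.+1 by lia.
nia.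
Qed.

(** [Z n] is the value of the crossing number in [crossings_small_side_sum] when every
    [small_side_sum] equals its lower bound. *)
Lemma Z_formula (e : bool) h n : 0 < h -> n = 2 * h + 2 + e ->
  Z n + 'C(n, 2) * (h * (h + e)) =
  3 * 'C(n, 4) + (3 * 'C(h.+3, 4) + 3 * 'C((h + e).+2, 4)).
Proof.
case: h => // h _ ->.
have E2 := bin2_mul2 (2 * h.+1 + 2 + e).
have E4 := bin4_mul24 (2 * h.+1 + 2 + e).
have F1 := bin4_mul24 h.+4.
have F2 := bin4_mul24 (h.+1 + e).+2.
have ZE : Z (2 * h.+1 + 2 + e) * 4 = h.+2 * (h.+1 + e) * h.+1 * (h + e).
  clear; case: e; last by rewrite !addn0 Z_even.
  by rewrite !addn1 -Z_odd; congr (Z _ * _); lia.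
move: (Z _) 'C(_, 2) 'C(_, 4) 'C(_, 4) 'C(_, 4) E2 E4 F1 F2 ZE => z c2 c4 f1 f2.
(* The final [lia] treats monomials as atoms, so the multiple of this equation that it needs is
   prepared here. *)
have E12 : c2 * 2 = (2 * h.+1 + 2 + e) * (2 * h + 3 + e) ->
  c2 * (h.+1 * (h.+1 + e)) * 24 =
  (2 * h.+1 + 2 + e) * (2 * h + 3 + e) * (h.+1 * (h.+1 + e)) * 12.
  by move=> <-; lia.
have -> : 2 * h.+1 + 2 + e - 1 = 2 * h + 3 + e by lia.
have -> : 2 * h.+1 + 2 + e - 2 = 2 * h + 2 + e by lia.
have -> : 2 * h.+1 + 2 + e - 3 = 2 * h + 1 + e by lia.
have -> : h.+4 - 1 = h.+3 by lia.
have -> : h.+4 - 2 = h.+2 by lia.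
have -> : h.+4 - 3 = h.+1 by lia.
have -> : (h.+1 + e).+2 - 1 = h.+2 + e by lia.
have -> : (h.+1 + e).+2 - 2 = h.+1 + e by lia.
have -> : (h.+1 + e).+2 - 3 = h + e by lia.
move=> /E12 E2; clear E12; case: e E2 => /=; lia.
Qed.

Lemma small_side_sum_optimal D (e : bool) h n K : 0 < h -> n = 2 * h + 2 + e ->
  crossings n D = Z n -> K <= h -> small_side_sum D K n = 3 * 'C(K.+2, 3).
Proof.
move=> h0 En cr Kh.
have E := @crossings_small_side_sum D e h n En.
have ge H : H <= h.+1 ->
    3 * 'C(H.+2, 4) <= \sum_(0 <= k < H) small_side_sum D k n.
  move=> Hh; rewrite -sum_bin3 big_distrr /=; apply: leq_sum_nat => k kH.
  by apply: small_side_sum_ge; lia.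
have Zf := Z_formula h0 En.
have g1 := ge h.+1 (leqnn _); have g2 := ge (h + e) ltac:(lia).
symmetry; apply: (@sum_nat_leq_eq (fun k => 3 * 'C(k.+2, 3))
  (fun k => small_side_sum D k n) 0 h.+1).
- by move=> k kh; apply: small_side_sum_ge; lia.
- by rewrite -big_distrr /= sum_bin3; lia.
- by lia.
Qed.

(** If [opp_side] is below n./2 - 1, [small_side_sum_tight] with [K] equal to [opp_side] itself
    forces every vertex before [i] to be counted. *)
Theorem star_last n D i j : 6 <= n -> crossings n D = Z n ->
  0 < i -> i < j -> j < n ->
  (forall x, 0 < x < i -> D x j != D i n) \/
  n./2 - 1 <= \sum_(j.+1 <= y < n) (D i y != D i n : nat)
     + (if D i j != D i n then 0 else j - i.+1)
     + \sum_(1 <= x < i) (D x j != D i n : nat).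
Proof.
move=> n6 cr i0 ij jn; case: n n6 cr jn => // N n6 cr jN.
have neq (x : bool) : (x != D i N.+1) = (x == ~~ D i N.+1) by rewrite eqb_neg.
case: (leqP (N.+1./2 - 1) (opp_side D N i j)) => le; [right|left].
  apply: leq_trans le _; rewrite /opp_side /side neq; apply: eq_leq.
  by congr (_ + _ + _); apply: eq_bigr => x _; rewrite neq.
have T := @small_side_sum_tight D (opp_side D N i j) N i j.
have : rank D (~~ D i N.+1) N i j + i.-1 <= opp_side D N i j.
  apply: T => //; first by lia.
  by apply: (@small_side_sum_optimal D (odd N.+1) (N.+1./2 - 1)) => //; lia.
rewrite /opp_side side_rank leq_add2l => ge x xi.
have := @sum_nat_leq_eq (fun x => D x j == ~~ D i N.+1) (fun=> 1) 1 i _ _ x xi.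
rewrite neq => H; have {}H : (D x j == ~~ D i N.+1 : nat) = 1.
  apply: H; first by move=> y _; case: (_ == _).
  by rewrite sum_nat_const_nat; lia.
by case: (_ == _) H.
Qed.

(** * Symmetries *)

(* Edges other than the spine edges and 1n: the colors of the latter are never used. *)
Definition chord (n i j : nat) : bool :=
  [&& 0 < i, i.+1 < j, j <= n & (1 < i) || (j < n)].

Definition eq_chords (n : nat) (D D' : coloring) : Prop :=
  forall i j, chord n i j -> D i j = D' i j.

Definition neg_coloring (D : coloring) : coloring := fun i j => ~~ D i j.

Lemma crossings_eqb n (D D' : coloring) :
  (forall i k j l, 0 < i -> i < k -> k < j -> j < l -> l <= n ->
    (D i j == D k l) = (D' i j == D' k l)) ->
  crossings n D = crossings n D'.
Proof.
move=> DD; rewrite !crossingsE; apply: eq_big_nat => l ln.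
apply: eq_sum_pairs => k j k0 kj jl; apply: eq_big_nat => i ik.
by congr nat_of_bool; apply: DD; lia.
Qed.

Lemma crossings_chords n D D' : eq_chords n D D' -> crossings n D = crossings n D'.
Proof.
by move=> DD; apply: crossings_eqb => i k j l *; rewrite !DD // /chord; lia.
Qed.

Lemma crossings_neg n D : crossings n (neg_coloring D) = crossings n D.
Proof.
by apply: crossings_eqb => i k j l *; rewrite /neg_coloring; case: (D i j); case: (D k l).
Qed.

Lemma sum_pairs_recl N F :
  sum_pairs N.+1 F =
  sum_pairs N (fun i j => F i.+1 j.+1) + \sum_(1 <= j < N.+1) F 1 j.+1.
Proof.
rewrite /sum_pairs big_nat_recl // [X in X + _]big_geq // add0n -big_split /=.
by apply: eq_big_nat => j jN; rewrite big_nat_recl 1?addnC //; lia.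
Qed.

(** Vertex 1 becomes the last one: crossings with smallest endpoint 1 turn into those with largest
    endpoint [n]. *)
Lemma crossings_trf n D : crossings n (trf n D) = crossings n D.
Proof.
rewrite !crossingsE; case: n => [|n]; first by rewrite /nested_crossings !big_geq.
rewrite /nested_crossings big_nat_recr //= [RHS]big_nat_recl //= addnC.
rewrite /crossings_last [X in _ = X + _]/sum_pairs [X in _ = X + _]big_geq // add0n.
have -> : \sum_(1 <= l < n.+1) sum_pairs l (fun k j => \sum_(1 <= i < k) (D i j == D k l.+1)) =
  \sum_(1 <= l < n.+1) (sum_pairs l.-1 (fun k j => (D 1 j.+1 == D k.+1 l.+1 : nat)) +
    sum_pairs l.-1 (fun k j => \sum_(1 <= i < k) (D i.+1 j.+1 == D k.+1 l.+1))).
  apply: eq_big_nat => l ln; case: l ln => // l ln.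
  rewrite sum_pairs_recl [X in _ + X]big1 ?addn0; last by move=> j _; rewrite big_geq.
  rewrite /= -sum_pairsD; apply: eq_sum_pairs => k j k0 kj jl.
  by rewrite big_nat_recl.
rewrite big_split /=; congr addn.
- rewrite /sum_pairs; apply: eq_big_nat => j jn; rewrite prednK; last by lia.
  apply: eq_big_nat => k kj; apply: eq_big_nat => i ik.
  have jn' : (j == n.+1) = false by lia.
  by rewrite /trf eqxx jn' eq_sym.
- apply: eq_big_nat => l ln; apply: eq_sum_pairs => k j k0 kj jl.
  apply: eq_big_nat => i ik.
  have jn' : (j == n.+1) = false by lia.
  have ln' : (l == n.+1) = false by lia.
  by rewrite /trf jn' ln'.
Qed.

Lemma crossings_trg n D : crossings n (trg n D) = crossings n D.
Proof.
pose F (D : coloring) i k j l : nat :=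
  [&& 1 <= i, i < k, k < j, j < l, l <= n & D i j == D k l].
(* Once the sums start at 1, [big_nat_rev] is the reflection of x to n + 1 - x. *)
have E D' : crossings n D' = \sum_(1 <= i < n.+1) \sum_(1 <= k < n.+1)
    \sum_(1 <= j < n.+1) \sum_(1 <= l < n.+1) F D' i k j l.
  have F0 i k j l : ~~ [&& 1 <= i, i < k, k < j, j < l & l <= n] -> F D' i k j l = 0.
    move=> H; apply/eqP; rewrite /F eqb0; apply: contra H.
    by move=> /and5P[-> -> -> ->]/andP[-> _].
  have R (G : nat -> nat) : (G 0 = 0) -> \sum_(i < n.+1) G i = \sum_(1 <= i < n.+1) G i.
    by move=> G0; rewrite -(big_mkord xpredT G) big_ltn // G0.
  rewrite /crossings
    (R (fun i => \sum_(k < n.+1) \sum_(j < n.+1) \sum_(l < n.+1) F D' i k j l));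
    last by do 3!(rewrite big1 // => ? _); apply: F0; lia.
  apply: eq_bigr => i _; rewrite (R (fun k => \sum_(j < n.+1) \sum_(l < n.+1) F D' i k j l));
    last by do 2!(rewrite big1 // => ? _); apply: F0; lia.
  apply: eq_bigr => k _; rewrite (R (fun j => \sum_(l < n.+1) F D' i k j l));
    last by do 1!(rewrite big1 // => ? _); apply: F0; lia.
  apply: eq_bigr => j _; rewrite (R (F D' i k j)) //.
  by apply: F0; lia.
rewrite !E big_nat_rev /=.
under eq_bigr => i _.
  rewrite big_nat_rev /=.
  under eq_bigr => k _.
    rewrite big_nat_rev /=; under eq_bigr => j _ do rewrite big_nat_rev /=.
    rewrite exchange_big /=; over.
  rewrite exchange_big /=.
  under eq_bigr => l _ do rewrite exchange_big /=.
  over.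
rewrite exchange_big /=; apply: eq_big_nat => l ln.
rewrite exchange_big /=; apply: eq_big_nat => j jn.
rewrite exchange_big /=; apply: eq_big_nat => k kn; apply: eq_big_nat => i i_n.
rewrite /F /trg; congr nat_of_bool.
have S x : 1 <= x < n.+1 -> n.+1 - (1 + n.+1 - x.+1) = x by lia.
rewrite !S // [D l k == _]eq_sym.
by case: (D j i == D l k); lia.
Qed.

(* The representative of [a] modulo [n] in 1, ..., n. *)
Definition wrap (n a : nat) : nat := ((a + n.-1) %% n).+1.

(** With indices read modulo [n] and unordered pairs, rotations become translations. *)
Definition cyclic_ext (n : nat) (D : coloring) : coloring :=
  fun a b => if wrap n a < wrap n b then D (wrap n a) (wrap n b)
             else D (wrap n b) (wrap n a).

Definition cyclic (n : nat) (c : coloring) : Prop :=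
  (forall a b, c a b = c b a) /\ (forall a b, c (a + n) b = c a b).

Lemma wrap_id n a : 0 < a <= n -> wrap n a = a.
Proof.
move=> an; rewrite /wrap (_ : a + n.-1 = a.-1 + n); last by lia.
by rewrite modnDr modn_small; lia.
Qed.

Lemma cyclic_ext_id n D a b : 0 < a -> a < b -> b <= n -> cyclic_ext n D a b = D a b.
Proof. by move=> *; rewrite /cyclic_ext !wrap_id; [case: ifP => //; lia|lia|lia]. Qed.

Lemma cyclic_ext_cyclic n D : cyclic n (cyclic_ext n D).
Proof.
split=> a b; rewrite /cyclic_ext.
- by case: (ltngtP (wrap n a) (wrap n b)) => // ->.
- by rewrite /wrap addnAC modnDr.
Qed.

Lemma neg_cyclic n c : cyclic n c -> cyclic n (neg_coloring c).
Proof. by case=> S P; split=> a b; rewrite /neg_coloring ?P // S. Qed.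

Definition rot_coloring (u : nat) (c : coloring) : coloring :=
  fun a b => c (u + a) (u + b).

Lemma rot_cyclic n u c : cyclic n c -> cyclic n (rot_coloring u c).
Proof. by case=> S P; split=> a b; rewrite /rot_coloring ?addnA ?P // S. Qed.

(** Agreement is asked on chords only, because [neg_coloring] also changes the spine edges and
    1n. *)
Definition reachable (n : nat) (D c : coloring) : Prop :=
  [/\ cyclic n c, crossings n c = Z n &
      exists s, eq_chords n c (foldr (apply_tr n) D s)].

Lemma reachable_cyclic_ext n D : crossings n D = Z n -> reachable n D (cyclic_ext n D).
Proof.
have E : eq_chords n (cyclic_ext n D) D.
  by move=> i j ij; apply: cyclic_ext_id; move: ij; rewrite /chord; lia.
move=> cr; split; first exact: cyclic_ext_cyclic; last by exists [::].
by rewrite (crossings_chords E).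
Qed.

Lemma reachable_neg n D c : reachable n D c -> reachable n D (neg_coloring c).
Proof.
case=> cyc cr [s E]; split; [exact: neg_cyclic|by rewrite crossings_neg|].
exists (TH :: s) => i j ij; rewrite /= /trh /neg_coloring -E //.
by case: ifP => //; move: ij; rewrite /chord; lia.
Qed.

Lemma rot1_trf n c : cyclic n c -> eq_chords n (rot_coloring 1 c) (trf n c).
Proof.
case=> S P i j ij; rewrite /rot_coloring /trf; case: eqP => [->|//].
by rewrite S P.
Qed.

Lemma trf_chords n c c' : eq_chords n c c' -> eq_chords n (trf n c) (trf n c').
Proof.
move=> E i j; rewrite /chord /trf => ij.
by case: eqP => ?; apply: E; rewrite /chord; lia.
Qed.

Lemma trg_chords n c c' : eq_chords n c c' -> eq_chords n (trg n c) (trg n c').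
Proof. by move=> E i j; rewrite /chord /trg => ij; apply: E; rewrite /chord; lia. Qed.

Lemma eq_chords_trans n D1 D2 D3 :
  eq_chords n D1 D2 -> eq_chords n D2 D3 -> eq_chords n D1 D3.
Proof. by move=> E F i j ij; rewrite E // F. Qed.

Lemma reachable_rot n D u c : reachable n D c -> reachable n D (rot_coloring u c).
Proof.
elim: u c => [|u IH] c rc; first exact: rc.
have [cyc cr [s E]] := rc.
rewrite -[rot_coloring u.+1 c]/(rot_coloring u (rot_coloring 1 c)).
apply: IH; split; first exact: rot_cyclic.
  by rewrite (crossings_chords (rot1_trf cyc)) crossings_trf.
exists (TF :: s); apply: eq_chords_trans (rot1_trf cyc) _.
exact: trf_chords.
Qed.

Lemma reachable_trg n D c : reachable n D c -> reachable n D (cyclic_ext n (trg n c)).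
Proof.
case=> cyc cr [s E].
have H : eq_chords n (cyclic_ext n (trg n c)) (trg n c).
  by move=> i j ij; apply: cyclic_ext_id; move: ij; rewrite /chord; lia.
split; first exact: cyclic_ext_cyclic.
  by rewrite (crossings_chords H) crossings_trg.
by exists (TG :: s); apply: eq_chords_trans H _; apply: trg_chords.
Qed.

(* The reflection of the circle that fixes the vertex 1. *)
Definition mirror (n : nat) (c : coloring) : coloring := cyclic_ext n (trg n (rot_coloring 1 c)).

Lemma reachable_mirror n D c : reachable n D c -> reachable n D (mirror n c).
Proof. by move=> rc; apply/reachable_trg/reachable_rot. Qed.

Lemma mirrorE n c a b : 0 < a -> a < b -> b <= n ->
  mirror n c a b = c (n.+2 - b) (n.+2 - a).
Proof.
move=> a0 ab bn; rewrite /mirror cyclic_ext_id // /trg /rot_coloring.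
by congr c; lia.
Qed.

(** This is [star_last] after a rotation that makes [u] the last vertex; [v] and [w] play the roles
    of [i] and [j]. *)
Definition star (n : nat) (c : coloring) : Prop :=
  forall u v w, u < v -> v < w -> w < u + n ->
  (forall x, u < x < v -> c x w != c v u) \/
  n./2 - 1 <= \sum_(w.+1 <= y < u + n) (c v y != c v u : nat)
     + (if c v w != c v u then 0 else w - v.+1)
     + \sum_(u.+1 <= x < v) (c x w != c v u : nat).

Lemma sum_nat_shift (F : nat -> nat) u a b a' b' : a' = u + a -> b' = u + b ->
  \sum_(a <= x < b) F (u + x) = \sum_(a' <= x < b') F x.
Proof.
move=> -> ->; rewrite [in RHS]addnC big_addn (_ : u + b - u = b); last by lia.
by apply: eq_bigr => x _; rewrite addnC.
Qed.

Lemma reachable_star n D c : 6 <= n -> reachable n D c -> star n c.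
Proof.
move=> n6 rc u v w uv vw wu.
have [_ cr _] := reachable_rot u rc; have [[S P] _ _] := rc.
have := @star_last n (rot_coloring u c) (v - u) (w - u) n6 cr.
rewrite /rot_coloring; have -> : u + (v - u) = v by lia.
have -> : u + (w - u) = w by lia.
rewrite (S v (u + n)) P (S u v) => H.
case: (H ltac:(lia) ltac:(lia) ltac:(lia)) => {}H; [left => x xuv|right].
  by have := H (x - u) ltac:(lia); have -> : u + (x - u) = x by lia.
apply: leq_trans H _; apply: eq_leq; congr (_ + _ + _).
- by apply: (sum_nat_shift (fun y => c v y != c v u : nat)); lia.
- by case: ifP => // _; lia.
- by apply: (sum_nat_shift (fun x => c x w != c v u : nat)); lia.
Qed.

(** * Structure of optimal colorings *)

Lemma sum_nat_ge1 (F : nat -> nat) a b i : a <= i < b -> F i <= \sum_(a <= x < b) F x.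
Proof.
move=> iab; rewrite (@big_cat_nat _ _ _ i) /=; [|lia|lia].
by rewrite [X in _ + X]big_ltn; lia.
Qed.

Lemma sum_nat_ge2 (F : nat -> nat) a b i k : a <= i -> i < k -> k < b ->
  F i + F k <= \sum_(a <= x < b) F x.
Proof.
move=> ai ik kb; rewrite (@big_cat_nat _ _ _ k) /=; [|lia|lia].
by apply: leq_add; apply: sum_nat_ge1; lia.
Qed.

Lemma sum_bool_lt (P : nat -> bool) a b i : a <= i < b -> ~~ P i ->
  \sum_(a <= x < b) (P x : nat) < b - a.
Proof.
move=> iab Pi; have := @sum_nat_ge1 (fun x => ~~ P x) a b i iab.
by have := @sum_bool_split P (fun x => ~~ P x) a b (fun x => erefl); rewrite Pi; lia.
Qed.

Lemma sum_bool_lt2 (P : nat -> bool) a b i k : a <= i -> i < k -> k < b ->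
  ~~ P i -> ~~ P k -> (\sum_(a <= x < b) (P x : nat)).+1 < b - a.
Proof.
move=> ai ik kb Pi Pk; have := @sum_nat_ge2 (fun x => ~~ P x) a b i k ai ik kb.
by have := @sum_bool_split P (fun x => ~~ P x) a b (fun x => erefl); rewrite Pi Pk; lia.
Qed.

Lemma sum_bool0 (P : nat -> bool) a b :
  (forall x, a <= x < b -> ~~ P x) -> \sum_(a <= x < b) (P x : nat) = 0.
Proof.
by move=> P0; rewrite big1_seq // => x /=; rewrite mem_index_iota => /P0/negbTE->.
Qed.

Lemma sum_bool_all (P : nat -> bool) a b :
  (forall x, a <= x < b -> P x) -> \sum_(a <= x < b) (P x : nat) = b - a.
Proof.
move=> P1; rewrite -[RHS]muln1 -sum_nat_const_nat.
by apply: eq_big_nat => x /P1->.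
Qed.

Lemma sum_bool_left (P : nat -> bool) a b d : a <= d -> d <= b ->
  (forall x, d <= x < b -> ~~ P x) ->
  \sum_(a <= x < b) (P x : nat) = \sum_(a <= x < d) (P x : nat).
Proof.
by move=> ad db P0; rewrite (big_cat_nat ad db) /= [X in _ + X]sum_bool0 // addn0.
Qed.

Lemma sum_bool_right (P : nat -> bool) a b d : a <= d -> d <= b ->
  (forall x, a <= x < d -> ~~ P x) ->
  \sum_(a <= x < b) (P x : nat) = \sum_(d <= x < b) (P x : nat).
Proof.
by move=> ad db P0; rewrite (big_cat_nat ad db) /= [X in X + _]sum_bool0.
Qed.

Section Structure.

Variables (n m : nat) (e : bool) (c : coloring).
Hypotheses (nE : n = 2 * m + e) (m3 : 2 < m) (cyc : cyclic n c) (st : star n c).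

Let cC a b : c a b = c b a. Proof. by case: cyc. Qed.
Let cn a b : c (n + a) b = c a b. Proof. by case: cyc => _ P; rewrite addnC P. Qed.
Let cn' a b : c a (n + b) = c a b. Proof. by rewrite cC cn cC. Qed.
Let half_n : n./2 = m. Proof. lia. Qed.

(** Otherwise [star] at q, r, n + p fails: [x] violates the first alternative, and the count is at
    most (q - p - 1) + (r - q - 2), which is below m - 1. *)
Lemma quad_color p q x r : p < q -> q < x -> x < r -> r <= p + m + 1 ->
  c p x = c q r -> c p r = c p x.
Proof.
move=> pq qx xr rp E; apply/eqP/negPn/negP => ne.
have := @st q r (n + p) ltac:(lia) ltac:(lia) ltac:(lia).
rewrite half_n cn' (cC r p) (cC r q) -E ne.
case=> [H|].
  by have := H x; rewrite qx xr cn' cC eqxx => /(_ isT).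
rewrite addn0.
have := sum_bool_le (fun y => c r y != c p x) (n + p).+1 (q + n).
have := @sum_bool_lt (fun y => c y (n + p) != c p x) q.+1 r x.
rewrite qx xr cn' (cC x p) eqxx => /(_ isT isT).
set S1 := \sum_(_ <= _ < _) _; set S2 := \sum_(_ <= _ < _) _.
lia.
Qed.

(* Otherwise all the longest chords have one color; the chord from [0] to [k],
   with [k] the last vertex of the half circle reached from [0] by the other color,
   then contradicts [star], since [k] is an end of a longest chord as well. *)
Lemma exists_change :
  exists v, c v (v + m) != c v (v + m + 1) \/
            (~~ e /\ c v (v + m - 1) != c v (v + m)).
Proof.
pose chg v := (c v (v + m) != c v (v + m + 1)) || (~~ e && (c v (v + m - 1) != c v (v + m))).
case: (boolP [exists v : 'I_n, chg v]) => [/existsP[v]|/existsPn nochg].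
  by case/orP=> [?|/andP[]]; exists v; [left|right].
have H v : v < n -> c v (v + m) = c v (v + m + 1) /\ (~~ e -> c v (v + m - 1) = c v (v + m)).
  move=> vn; have := nochg (Ordinal vn); rewrite /chg /= negb_or negbK negb_and negbK.
  by case/andP=> /eqP-> /orP[->|/negPn/eqP->].
(* A zigzag of chords leads from v(v + m) to the next one; consecutive chords share an end and have
   equal colors by [H]. *)
have dS v : v.+1 < m -> c v.+1 (v.+1 + m) = c v (v + m).
  move=> vm; case: (boolP e) => [eT|ef].
  - rewrite cC -(cn' (v.+1 + m)) (_ : n + v.+1 = (v.+1 + m) + m + 1); last by lia.
    have [<- _] := H (v.+1 + m) ltac:(lia).
    rewrite (_ : v.+1 + m + m = n + v) ?cn' ?(cC _ v); last by lia.
    by have [-> _] := H v ltac:(lia); congr c; lia.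
  - have [_ /(_ ef) <-] := H v.+1 ltac:(lia).
    rewrite (_ : v.+1 + m - 1 = v + m); last by lia.
    rewrite cC -(cn' (v + m)) (_ : n + v.+1 = (v + m) + m + 1); last by lia.
    have [<- _] := H (v + m) ltac:(lia).
    by rewrite (_ : v + m + m = n + v) ?cn' 1?cC //; lia.
have d0 v : v < m -> c v (v + m) = c 0 m.
  by elim: v => [|v IH] vm; [rewrite add0n | rewrite dS // IH //; lia].
have c01 : c 0 (m + 1) = c 0 m by have [E _] := H 0 ltac:(lia); rewrite -(add0n m) -E.
(* The value 1 is a default, for the case that no chord from 0 into this half circle has the other
   color. *)
pose P k := (0 < k <= m) && ((k == 1) || (c 0 k != c 0 m)).
have [k /andP[km Pk] kmax] : exists2 k, P k & forall k', P k' -> k' <= k.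
  have exP : exists k, P k by exists 1; rewrite /P eqxx; lia.
  have bP k : P k -> k <= m by case/andP; lia.
  by case: (ex_maxnP exP bP) => k; exists k.
have k_m : k < m.
  by case: (ltngtP k m) => // kE; [lia | move: Pk; rewrite kE eqxx orbF; lia].
(* This longest chord at [k] rules out the first alternative of [star]. *)
have [x xr cx] : exists2 x, m + 1 < x < n & c k x = c 0 m.
  case: (boolP (k + m + 1 < n)) => le.
    by exists (k + m + 1); [lia | have [<- _] := H k ltac:(lia); exact: d0].
  by exists (k + m); [lia | exact: d0].
have := @st (m + 1) n (n + k) ltac:(lia) ltac:(lia) ltac:(lia).
have cn0 y : c n y = c 0 y by rewrite -{1}(addn0 n) cn.
rewrite half_n !cn0 !cn' c01; case=> [A|].
  by have := A x xr; rewrite cn' cC cx eqxx.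
rewrite sum_bool0 => [|y ky]; last first.
  rewrite cn0; apply/negP => ny.
  have := kmax (y - n); rewrite /P -[c 0 (y - n)](cn' 0) (_ : n + (y - n) = y); last by lia.
  by rewrite ny orbT; lia.
have := @sum_bool_lt (fun x => c x (n + k) != c 0 m) (m + 1).+1 n x ltac:(lia).
rewrite cn' (cC x) cx eqxx => /(_ isT).
set S := \sum_(_ <= _ < _) _.
case: ifP => [|/negbFE/eqP kE]; first by lia.
by move: Pk; rewrite kE eqxx orbF => /eqP ->; lia.
Qed.

End Structure.

(* [M.+1] and [M.+2] are the vertices opposite to 1 at which the color changes. *)
Section Anchored.

Variables (n m : nat) (e : bool) (c : coloring).
Hypotheses (nE : n = 2 * m + e) (m3 : 2 < m) (cyc : cyclic n c) (st : star n c).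
Hypothesis st' : star n (mirror n c).
Let M := m - 1 + e.
Hypotheses (anchor_blue : c 1 M.+1 = true) (anchor_red : c 1 M.+2 = false).

Let cC a b : c a b = c b a. Proof. by case: cyc. Qed.
Let cn a b : c (n + a) b = c a b. Proof. by case: cyc => _ P; rewrite addnC P. Qed.
Let cn' a b : c a (n + b) = c a b. Proof. by rewrite cC cn cC. Qed.
Let half_n : n./2 = m. Proof. lia. Qed.
Let Q := quad_color nE m3 cyc st.

(** A red chord from [M.+1] to [y] would cross the red chord from [M.+2] to 1 and turn the blue
    anchor red. *)
Lemma row_blue y : M + 3 <= y -> y <= n.+1 -> c M.+1 y = true.
Proof.
move=> yM yn; apply/negPn/negP => /negbTE ry.
have An : c M.+1 (n + 1) = true by rewrite cn' cC.
have Bn : c M.+2 (n + 1) = false by rewrite cn' cC.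
case: (ltngtP y n.+1) => [yn'||yE]; [|lia|by move: ry; rewrite yE -[n.+1]addn1 An].
have := @Q M.+1 M.+2 y (n + 1) ltac:(lia) ltac:(lia) ltac:(lia) ltac:(lia).
by rewrite ry Bn An => /(_ erefl).
Qed.

Lemma col_red x : 0 < x -> x <= M -> c x M.+2 = false.
Proof.
move=> x0 xM; apply/negP => bx.
case: (ltngtP x 1) => [|x1|xE]; [lia| |by move: bx; rewrite xE anchor_red].
have := @Q 1 x M.+1 M.+2 ltac:(lia) ltac:(lia) ltac:(lia) ltac:(lia).
by rewrite bx anchor_blue anchor_red => /(_ erefl).
Qed.

(** In [star] at 1, [M.+1], [j] the blue row removes the first sum and the middle term is j - M - 2,
    which leaves n - j for the column. *)
Lemma col_count_red j : M + 3 <= j -> j <= n ->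
  n - j <= \sum_(2 <= x < M.+1) (~~ c x j : nat).
Proof.
move=> jM jn.
have := @st 1 M.+1 j ltac:(lia) ltac:(lia) ltac:(lia).
rewrite half_n (cC M.+1 1) anchor_blue.
case=> [H|].
  rewrite sum_bool_all => [|x xM]; first by lia.
  by have := H x; rewrite (_ : 1 < x < M.+1) // eqb_id => /(_ isT).
rewrite sum_bool0 => [|y yj]; last by rewrite row_blue //; lia.
have -> : \sum_(2 <= x < M.+1) (c x j != true : nat) = \sum_(2 <= x < M.+1) (~~ c x j : nat).
  by apply: eq_bigr => x _; rewrite eqb_id.
by case: ifP; lia.
Qed.

(** The reflected count, with [col_red] in place of [row_blue]. The anchors are not symmetric for
    odd [n], hence the loss of [e]. *)
Lemma row_count_blue i : 2 <= i -> i <= M ->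
  i - 1 - e <= \sum_(M + 3 <= y < n.+1) (c i y : nat).
Proof.
move=> i2 iM.
have := @st' 1 (n - M) (n + 2 - i) ltac:(lia) ltac:(lia) ltac:(lia).
have [sym' _] : cyclic n (mirror n c) by exact: cyclic_ext_cyclic.
have -> : mirror n c (n - M) 1 = false.
  rewrite sym' mirrorE; [|lia|lia|lia].
  have -> : n.+2 - (n - M) = M.+2 by lia.
  have -> : n.+2 - 1 = n + 1 by lia.
  by rewrite cn' cC.
have colE x : 2 <= x < n - M -> mirror n c x (n + 2 - i) = c i (n + 2 - x).
  move=> xM; rewrite mirrorE; [|lia|lia|lia].
  by congr c; lia.
rewrite half_n.
case=> [H|].
  rewrite sum_bool_all => [|y yM]; first by lia.
  have := H (n + 2 - y) ltac:(lia); rewrite colE; last by lia.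
  by have -> : n + 2 - (n + 2 - y) = y; [lia | case: (c i y)].
rewrite sum_bool0 => [|y yj]; last first.
  rewrite mirrorE; [|lia|lia|lia].
  have -> : n.+2 - (n - M) = M.+2 by lia.
  by rewrite col_red //; lia.
have -> : \sum_(2 <= x < n - M) (mirror n c x (n + 2 - i) != false : nat)
  = \sum_(M + 3 <= y < n.+1) (c i y : nat).
  rewrite [RHS]big_nat_rev /=.
  rewrite -(@sum_nat_shift (fun y => c i (M + 3 + n.+1 - y.+1)) (M + 1) 2 (n - M));
    [|lia|lia].
  apply: eq_big_nat => x xM; rewrite colE //.
  have -> : M + 3 + n.+1 - (M + 1 + x).+1 = n + 2 - x by lia.
  by case: (c i _).
by case: ifP; lia.
Qed.

(* The block of rows 2, ..., M and columns M + 3, ..., n is determined from its lower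
   left corner, one column and one row at a time, because the two counting lemmas above
   leave at most one entry of the next column (row) undecided. *)
Definition block_rows t := forall i j, 2 <= i -> i <= M -> M.+1 <= i + t ->
  M + 3 <= j -> j <= n -> n + 2 + e <= i + j -> c i j = true.
Definition block_cols t := forall i j, 2 <= i -> i <= M -> M + 3 <= j -> j <= n ->
  j <= M + 2 + t -> i + j <= n + 1 -> c i j = false.

Lemma block_col_step t : block_rows t -> block_cols t -> block_cols t.+1.
Proof.
move=> BR BC i j i2 iM jM jn jt ij.
case: (leqP j (M + 2 + t)) => jt'; first exact: BC.
apply/negP => bij.
have cnt := @col_count_red j jM jn.
(* The n - j red entries lie among n - j + e rows, so at most [e] of these are blue. Hence [n] is
   odd and [i] is the only one. *)
rewrite (@sum_bool_left _ 2 M.+1 (n + 2 + e - j)) in cnt; [|lia|lia| ]; last first.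
  by move=> x xj; rewrite BR //; lia.
have lt1 := @sum_bool_lt (fun x => ~~ c x j) 2 (n + 2 + e - j) i ltac:(lia).
rewrite bij in lt1; have {}lt1 := lt1 isT.
have eT : e by lia.
have red1 : c i.+1 j = false.
  apply/negP => b1.
  have := @sum_bool_lt2 (fun x => ~~ c x j) 2 (n + 2 + e - j) i i.+1.
  by rewrite bij b1 => /(_ i2 (leqnn _) ltac:(lia) isT isT); lia.
case: (leqP (j - i) (m + 1)) => span.
  have := @Q i i.+1 M.+2 j ltac:(lia) ltac:(lia) ltac:(lia) ltac:(lia).
  by rewrite bij red1 col_red; [move=> /(_ erefl)|lia|lia].
(* Now the complementary arc from [j] to n + i + 1 is short enough for [quad_color]; an entirely red
   row i + 1 contradicts [row_count_blue]. *)
have row_red y : M + 3 <= y < n.+1 -> c i.+1 y = false.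
  move=> yM; case: (ltngtP y j) => [yj|yj|->]; last exact: red1.
    by apply: BC; lia.
  apply/negP => b1.
  have := @Q j y (n + i) (n + i.+1) ltac:(lia) ltac:(lia) ltac:(lia) ltac:(lia).
  by rewrite !cn' !(cC j) (cC y) bij b1 red1 => /(_ erefl).
have := @row_count_blue i.+1 ltac:(lia) ltac:(lia).
by rewrite sum_bool0 => [|y /row_red->]; lia.
Qed.

(** The argument of [block_col_step] with rows and columns, and the two colors, exchanged. *)
Lemma block_row_step t : block_rows t -> block_cols t.+1 -> block_rows t.+1.
Proof.
move=> BR BC i j i2 iM it jM jn ij.
case: (leqP M.+1 (i + t)) => it'; first exact: BR.
apply/negPn/negP => rij.
have cnt := @row_count_blue i i2 iM.
rewrite (@sum_bool_right _ (M + 3) n.+1 (n + 2 - i)) in cnt; [|lia|lia| ]; last first.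
  by move=> y yi; rewrite BC //; lia.
have lt1 := @sum_bool_lt (c i) (n + 2 - i) n.+1 j ltac:(lia) rij.
have eT : e by lia.
have blue1 : c i j.-1 = true.
  apply/negPn/negP => r1.
  have := @sum_bool_lt2 (c i) (n + 2 - i) n.+1 j.-1 j.
  by move=> /(_ ltac:(lia) ltac:(lia) ltac:(lia) r1 rij); lia.
case: (leqP (j - i) (m + 1)) => span.
  have := @Q i M.+1 j.-1 j ltac:(lia) ltac:(lia) ltac:(lia) ltac:(lia).
  by rewrite blue1 row_blue; [rewrite (negbTE rij) => /(_ erefl)|lia|lia].
have col_blue x : 2 <= x < M.+1 -> c x j.-1 = true.
  move=> xM; case: (ltngtP x i) => [xi|xi|->]; last exact: blue1.
    apply/negPn/negP => rx.
    have := @Q j.-1 j (n + x) (n + i) ltac:(lia) ltac:(lia) ltac:(lia) ltac:(lia).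
    by rewrite !cn' !(cC j) !(cC j.-1) (negbTE rx) (negbTE rij) blue1 => /(_ erefl).
  by apply: BR; lia.
have := @col_count_red j.-1 ltac:(lia) ltac:(lia).
by rewrite sum_bool0 => [|x /col_blue->]; lia.
Qed.

Lemma block t : block_rows t /\ block_cols t.
Proof.
elim: t => [|t [BR BC]]; first by split=> i j *; lia.
have BC' := block_col_step BR BC; split=> //; exact: block_row_step.
Qed.

(** For odd [n], [block] leaves the antidiagonal i + j = n + 2 undecided, and this entry lies on
    it. *)
Hypothesis e_2n : e -> c 2 n = true.

(** A blue 1j would cross the blue 2n and make 2j blue, against [block]. *)
Lemma row1_red j : M + 2 <= j -> j < n -> c 1 j = false.
Proof.
move=> jM jn; case: (leqP j (M + 2)) => jM'.
  by rewrite (_ : j = M.+2); [exact: anchor_red|lia].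
apply/negP => bj.
have [BR BC] := block n.
have r2 : c 2 j = false by apply: BC; lia.
have b2 : c 2 n = true.
  by case: (boolP e) => [/e_2n//|/negbTE ef]; apply: BR; rewrite ?ef; lia.
have := @Q j n (n + 1) (n + 2) ltac:(lia) ltac:(lia) ltac:(lia) ltac:(lia).
by rewrite !cn' !(cC j) (cC n) bj b2 r2 => /(_ erefl).
Qed.

Lemma wide_red i j : 0 < i -> i <= M.+1 -> M + 2 <= j -> j <= n -> i + j <= n + 1 ->
  (1 < i) || (j < n) -> i.+1 < j -> c i j = false.
Proof.
move=> i0 iM jM jn ij b1 b2; have [BR BC] := block n.
case: (leqP i M) => iM'; last by lia.
case: (leqP j (M + 2)) => jM'.
  by rewrite (_ : j = M.+2); [exact: col_red|lia].
case: (leqP i 1) => i1; last by apply: BC; lia.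
by rewrite (_ : i = 1); [apply: row1_red; lia|lia].
Qed.

Lemma wide_blue i j : 0 < i -> i <= M.+1 -> M + 2 <= j -> j <= n -> n + 2 + e <= i + j ->
  c i j = true.
Proof.
move=> i0 iM jM jn ij; have [BR BC] := block n.
case: (leqP i M) => iM'; last by rewrite (_ : i = M.+1); [apply: row_blue; lia|lia].
by apply: BR; lia.
Qed.

(** A red xw would cross the red chord from x + 1 to n - x and make the blue chord from [w] to n - x
    red. The bound on x + w keeps the arc within reach of [quad_color]. *)
Lemma left_blue x w : 0 < x -> x + 2 + e <= w -> w <= M.+1 -> x + w <= m + 1 ->
  c x w = true.
Proof.
move=> x0 xw wM s; apply/negPn/negP => /negbTE r.
have := @Q (n - x) (n + x) (n + x.+1) (n + w) ltac:(lia) ltac:(lia) ltac:(lia) ltac:(lia).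
rewrite !cn' cn r !(cC (n - x)).
rewrite wide_red; [|lia..]; rewrite wide_blue; [|lia..].
by move=> /(_ erefl).
Qed.

(** Here the crossing chord is the blue one from x - 1 to n + 3 + e - x, on the first blue
    antidiagonal of [wide_blue]. *)
Lemma left_red w x : 0 < w -> w + 2 + e <= x -> x <= M.+1 -> m + 2 + 2 * e <= w + x ->
  3 + e <= x -> c w x = false.
Proof.
move=> w0 wx xM s x3; apply/negP => b.
have := @Q w x.-1 x (n + 3 + e - x) ltac:(lia) ltac:(lia) ltac:(lia) ltac:(lia).
rewrite b (@wide_red w); [|lia..]; rewrite wide_blue; [|lia..].
by move=> /(_ erefl).
Qed.

Lemma right_red w y : M + 2 <= w -> w + 2 + e <= y -> y <= n ->
  n + m + 2 + 2 * e <= w + y -> c w y = false.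
Proof.
move=> wM wy yn s; apply/negP => b.
have := @Q w y.-1 y (n + (n + 3 + e - y)) ltac:(lia) ltac:(lia) ltac:(lia) ltac:(lia).
rewrite !cn' b !(cC _ (n + 3 + e - y)).
rewrite (@wide_red _ w); [|lia..]; rewrite wide_blue; [|lia..].
by move=> /(_ erefl).
Qed.

Lemma right_blue x w : M + 2 <= x -> x + 2 + e <= w -> w <= n ->
  x + w <= n + m + 1 -> c x w = true.
Proof.
move=> xM xw wn s; apply/negPn/negP => /negbTE r.
have := @Q (n - x) x x.+1 w ltac:(lia) ltac:(lia) ltac:(lia) ltac:(lia).
rewrite r wide_red; [|lia..]; rewrite wide_blue; [|lia..].
by move=> /(_ erefl).
Qed.

End Anchored.

(** * Normalization at vertex 1 and conclusion *)

Lemma exists_anchor n m (e : bool) D c : n = 2 * m + e -> 2 < m -> reachable n D c ->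
  exists c', [/\ reachable n D c', c' 1 (m - 1 + e).+1 = true,
    c' 1 (m - 1 + e).+2 = false & e -> c' 2 n = true].
Proof.
move=> nE m3 rc.
have n6 : 6 <= n by lia.
have cycS b : reachable n D b -> forall a d, b a d = b d a by case=> -[].
have cycP b : reachable n D b -> forall a d, b a (n + d) = b a d.
  by move=> rb a d; have [[S P] _ _] := rb; rewrite S addnC P S.
have [c1 r1 ne1] : exists2 c1, reachable n D c1 &
    c1 1 (m - 1 + e).+1 != c1 1 (m - 1 + e).+2.
  have [cyc _ _] := rc.
  have [v chg] := exists_change nE m3 cyc (reachable_star n6 rc).
  (* The summand [n] avoids truncation when [v] is 0. *)
  pose c0 := rot_coloring (v + n - 1) c.
  have r0 : reachable n D c0 by exact: reachable_rot.
  have c0E k : c0 1 k.+1 = c v (v + k).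
    rewrite /c0 /rot_coloring (_ : v + n - 1 + 1 = n + v); last by lia.
    rewrite (_ : v + n - 1 + k.+1 = n + (v + k)); last by lia.
    by rewrite cycP // (cycS c rc) cycP // (cycS c rc).
  case: chg => [chg|[/negbTE ef chg]].
  - have [eT|ef] := orP (orbN e).
      exists c0 => //; rewrite !c0E.
      rewrite (_ : m - 1 + e = m); last by lia.
      by rewrite -addn1 addnA.
    (* For even [n] this change lies one vertex too far; the reflection sends m + 1, m + 2 to m + 1,
       m. *)
    exists (mirror n c0); first exact: reachable_mirror.
    rewrite !mirrorE; [|lia..].
    rewrite (_ : n.+2 - 1 = n + 1) ?cycP //; last by lia.
    rewrite (_ : n.+2 - (m - 1 + e).+1 = (m + 1).+1); last by lia.
    rewrite (_ : n.+2 - (m - 1 + e).+2 = m.+1); last by lia.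
    by rewrite !(cycS c0 r0 _ 1) !c0E addnA eq_sym.
  - exists c0 => //; rewrite ef !c0E !addn0.
    rewrite (_ : v + (m - 1) = v + m - 1); last by lia.
    by rewrite (_ : v + (m - 1).+1 = v + m); last by lia.
have [c2 r2 [b2 d2]] : exists2 c2, reachable n D c2 &
    c2 1 (m - 1 + e).+1 = true /\ c2 1 (m - 1 + e).+2 = false.
  case E1: (c1 1 (m - 1 + e).+1) ne1; case E2: (c1 1 (m - 1 + e).+2) => // _.
    by exists c1.
  by exists (neg_coloring c1); [exact: reachable_neg | rewrite /neg_coloring E1 E2].
case: (boolP (e ==> c2 2 n)) => [/implyP b2n|].
  by exists c2; split.
rewrite negb_imply => /andP[eT d2n].
have ME : m - 1 + e = m by lia.
(* The reflection swaps [M.+1] with [M.+2] and preserves the edge 2n; the negation restores the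
   anchors and makes 2n blue. *)
exists (neg_coloring (mirror n c2)); split.
- exact/reachable_neg/reachable_mirror.
- rewrite /neg_coloring mirrorE ?ME; [|lia..].
  rewrite (_ : n.+2 - 1 = n + 1) ?cycP // ?(cycS c2 r2 _ 1); last by lia.
  by rewrite (_ : n.+2 - m.+1 = (m - 1 + e).+2) ?d2 //; lia.
- rewrite /neg_coloring mirrorE ?ME; [|lia..].
  rewrite (_ : n.+2 - 1 = n + 1) ?cycP // ?(cycS c2 r2 _ 1); last by lia.
  by rewrite (_ : n.+2 - m.+2 = (m - 1 + e).+1) ?b2 //; lia.
- move=> _; rewrite /neg_coloring mirrorE; [|lia..].
  rewrite (_ : n.+2 - n = 2); last by lia.
  by rewrite (_ : n.+2 - 2 = n); last by lia.
Qed.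

Theorem theorem19 (n : nat) (D : coloring) :
  6 <= n -> crossing_optimal n D ->
  let e := (odd n : nat) in
  exists D' : coloring, equivalent n D D' /\
    (* (1) *)
    (forall s r,
        ((4 + e <= s <= n./2 + 1) || (n + 2 + e <= s <= n + n./2 + 1)) ->
        maxn 1 (s - n) <= r -> 2 * r + 5 <= s ->
        D' r (s - r) = true) /\
    (* (2) *)
    (forall s r,
        ((uphalf n + 2 + e <= s <= n) ||
         (n + uphalf n + 2 + e <= s <= 2 * n - 2 - e)) ->
        maxn 1 (s - n) <= r -> 2 * r + 5 <= s ->
        ~ (r = 1 /\ s - r = n) ->
        D' r (s - r) = false) /\
    (* (3) *)
    (odd n ->
       [/\ D' 1 (uphalf n + 1) = false,
           D' n./2 (uphalf n + 1) = false,
           D' 2 n = true &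
           D' (uphalf n) (uphalf n + 2) = true]).
Proof.
move=> n6 [_ cr] e; rewrite /e => {e}.
have nE : n = 2 * n./2 + odd n by lia.
have uE : uphalf n = n./2 + odd n by lia.
have m3 : 2 < n./2 by lia.
move: (n./2) (uphalf n) nE uE m3 => m u nE -> m3.
have [c [rc ab ar e2n]] := exists_anchor nE m3 (reachable_cyclic_ext cr).
have [cyc _ [s E]] := rc.
have st := reachable_star n6 rc.
have st' := reachable_star n6 (reachable_mirror rc).
exists (foldr (apply_tr n) D s); split; first by exists s.
split; [|split].
- move=> t r ht hr ht5; rewrite -E; last by rewrite /chord; lia.
  (* The chord lies in the left half circle, joins the two halves, or lies in the right one. *)
  case: (leqP (t - r) (m - 1 + odd n).+1) => jM.
    by apply: (left_blue nE m3 cyc st st' ab ar e2n); lia.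
  case: (leqP r (m - 1 + odd n).+1) => iM.
    by apply: (wide_blue nE m3 cyc st st' ab ar); lia.
  by apply: (right_blue nE m3 cyc st st' ab ar e2n); lia.
- move=> t r ht hr ht5 ex; rewrite -E; last by rewrite /chord; lia.
  case: (leqP (t - r) (m - 1 + odd n).+1) => jM.
    by apply: (left_red nE m3 cyc st st' ab ar e2n); lia.
  case: (leqP r (m - 1 + odd n).+1) => iM.
    by apply: (wide_red nE m3 cyc st st' ab ar e2n); lia.
  by apply: (right_red nE m3 cyc st st' ab ar e2n); lia.
- move=> on; have ME : (m - 1 + odd n).+2 = m + odd n + 1 by lia.
  split; (rewrite -E; last by rewrite /chord; lia).
  + by rewrite -ME.
  + by rewrite -ME; apply: (col_red nE m3 cyc st ab ar); lia.
  + exact: e2n.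
  + have -> : m + odd n = (m - 1 + odd n).+1 by lia.
    by apply: (row_blue nE m3 cyc st ab ar); lia.
Qed.
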